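(* Let $\Gamma=\{1,\dots,m\}$, let $f_\gamma:\mathbb{R}^n\to\mathbb{R}^n$ ($\gamma\in\Gamma$) be continuous, write $f(\xi,\gamma)=f_\gamma(\xi)$, and consider the switched system $\dot x=f(x,\sigma)$. Assume that $\chi$ is a closed covering of $\mathbb{R}^n$ and $V:\Omega\times\Gamma\to\mathbb{R}$, with $\Omega$ an open subset of $\mathbb{R}^n$, is continuous. Let $\{(x_k,\sigma_k)\}$ be a sequence of maximal trajectories of the system belonging to $\mathcal{T}_V\cap\mathcal{T}[\chi]\cap\mathcal{T}_a[\tau_D,N_0]$, $\tau_D>0$, $N_0\in\mathbb{N}$, and suppose that there exists a compact subset $B\subset\Omega$ such that $x_k(t)\in B$ for all $t\ge0$ and all $k$. Then there exist a subsequence $\{(x_{k_l},\sigma_{k_l})\}$ and a maximal trajectory $(x^*,\sigma^* )\in\mathcal{T}_V\cap\mathcal{T}[\chi]\cap\mathcal{T}_a[\tau_D,N_0]$ such that $\{x_{k_l}\}$ converges to $x^*$ uniformly on compact subsets of $\mathbb{R}_+$ and $\lim_{l\to\infty}\sigma_{k_l}(t)=\sigma^*(t)$ for almost every $t\in\mathbb{R}_+$.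
   Context: Notation: $\mathbb{R}_+=[0,\infty)$, $\mathbb{N}$ is the set of positive integers. Switched system. $\Gamma$ carries the discrete metric. A switching signal is a piecewise constant, right-continuous function $\sigma:\mathbb{R}_+\to\Gamma$. Its switching times are $t_0=0$ and its consecutive discontinuities $t_1<t_2<\cdots$ (finitely many, or infinitely many tending to $\infty$). A solution of $\dot x=f(x,\sigma)$ corresponding to $\sigma$ is a (continuous) piecewise smooth curve $x:\mathcal{I}\to\mathbb{R}^n$, $\mathcal{I}=[0,T)$ or $[0,T]$, $0<T\le\infty$, with $\dot x(t)=f(x(t),\sigma(t))$ for all $t\in(t_i,t_{i+1})\cap\mathcal{I}$ and all $i$ (with $t_{i+1}=\infty$ if $t_i$ is the last switching time). A trajectory is a pair $(x,\sigma)$ with $x$ a solution corresponding to $\sigma$; it is maximal if $x$ is a maximal (non-extendable) solution, and its domain is then $\mathcal{I}_{(x,\sigma)}=[0,t_{(x,\sigma)})$. $\mathcal{T}$ is the set of all maximal trajectories. A closed covering of $\mathbb{R}^n$ is a family $\chi=\{\chi_\gamma:\gamma\in\Gamma\}$ of closed sets with $\bigcup_\gamma\chi_\gamma=\mathbb{R}^n$. $\mathcal{T}[\chi]$ is the set of $(x,\sigma)\in\mathcal{T}$ with $x(t)\in\chi_{\sigma(t)}$ for all $t\in\mathcal{I}_{(x,\sigma)}$. Average dwell-time. $\sigma$ has average dwell-time $\tau_D>0$ and chatter bound $N_0\in\mathbb{N}$ if the number of switching times of $\sigma$ in any open finite interval $(\tau_1,\tau_2)\subset\mathbb{R}_+$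 is at most $N_0+(\tau_2-\tau_1)/\tau_D$. $\mathcal{S}_a[\tau_D,N_0]$ is the set of such signals and $\mathcal{T}_a[\tau_D,N_0]$ the set of $(x,\sigma)\in\mathcal{T}$ with $\sigma\in\mathcal{S}_a[\tau_D,N_0]$. $\mathcal{T}_V$ is the set of $(x,\sigma)\in\mathcal{T}$ such that $x(t)\in\Omega$ for all $t\in\mathcal{I}_{(x,\sigma)}$ and $V(x(t),\sigma(t))\ge V(x(t'),\sigma(t'))$ whenever $t\le t'$ in $\mathcal{I}_{(x,\sigma)}$ and $\sigma(t)=\sigma(t')$. *)

(* Defs.v *)
From mathcomp Require Import all_boot all_order all_algebra finmap.
From mathcomp Require Import all_classical all_reals all_analysis.

Set Implicit Arguments.
Unset Strict Implicit.
Unset Printing Implicit Defensive.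

Import Order.TTheory GRing.Theory Num.Theory.
Import numFieldNormedType.Exports.

Local Open Scope classical_set_scope.
Local Open Scope ring_scope.

(* The index set Gamma = {1, ..., m}, as {0, ..., m - 1}, with the discrete
   metric. *)
Notation modes m := (discrete_topology 'I_m).

(* P holds on each piece ]a, b[ of some finite subdivision of [0, T]. *)
Definition piecewise (R : realType) (P : R -> R -> Prop) (T : R) : Prop :=
  exists2 s : seq R, itv_partition 0 T s &
    forall i, (i < size s)%N -> P (nth 0 (0 :: s) i) (nth 0 s i).

(* Signals are total functions on R; only their values on [0, +oo[ are ever
   used, and likewise only the values on its domain for a curve. *)
Definition switching_signal (R : realType) (m : nat) (sigma : R -> modes m) :
    Prop :=
  (forall T, 0 <= T ->
     piecewise (fun a b => exists c : modes m,
       forall t, a < t < b -> sigma t = c) T) /\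
  (forall t, 0 <= t -> sigma s @[s --> t^'+] --> sigma t).

Definition switching_times (R : realType) (m : nat) (sigma : R -> modes m) :
    set R :=
  [set t | t = 0 \/ (0 < t /\ ~ {for t, continuous sigma})].

Definition average_dwell_time (R : realType) (m : nat) (tauD : R) (N0 : nat)
    (sigma : R -> modes m) : Prop :=
  forall tau1 tau2 : R, 0 <= tau1 -> tau1 < tau2 ->
    let S := switching_times sigma `&` [set t | tau1 < t < tau2] in
    finite_set S /\
    (#|` fset_set S|)%:R <= N0%:R + (tau2 - tau1) / tauD.

(* Intervals [0, T) with 0 < T <= oo, or [0, T] with 0 < T < oo. *)
Definition time_interval (R : realType) (I : set R) : Prop :=
  I = [set t | 0 <= t] \/
  exists2 T : R, 0 < T & I = [set t | 0 <= t < T] \/ I = [set t | 0 <= t <= T].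

(* v is the derivative at t of the restriction of x to I (one-sided at an
   endpoint of I). *)
Definition derivative_in (R : realType) (n : nat) (I : set R)
    (x : R -> 'rV[R]_n) (t : R) (v : 'rV[R]_n) : Prop :=
  (s - t)^-1 *: (x s - x t) @[s --> within I t^'] --> v.

(* On each piece, the derivative exists in the interior and extends continuously
   to the closed piece; for a continuous curve this is C^1 up to the ends.
   C^1 is the highest regularity available for a continuous right-hand side. *)
Definition piecewise_smooth (R : realType) (n : nat) (I : set R)
    (x : R -> 'rV[R]_n) : Prop :=
  forall T, I T ->
    piecewise (fun a b => exists g : R -> 'rV[R]_n,
      {within [set t | a <= t <= b], continuous g} /\
      forall t, a < t < b -> derivative_in I x t (g t)) T.

(* Switching times being locally finite, the union of the intervals
   (t_i, t_{i+1}) is the complement of switching_times sigma in [0, +oo[. *)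
Definition solution (R : realType) (n m : nat)
    (f : 'rV[R]_n -> modes m -> 'rV[R]_n) (sigma : R -> modes m)
    (I : set R) (x : R -> 'rV[R]_n) : Prop :=
  [/\ time_interval I,
      {within I, continuous x},
      piecewise_smooth I x &
      forall t, I t -> ~ switching_times sigma t ->
        derivative_in I x t (f (x t) (sigma t))].

Definition maximal_solution (R : realType) (n m : nat)
    (f : 'rV[R]_n -> modes m -> 'rV[R]_n) (sigma : R -> modes m)
    (I : set R) (x : R -> 'rV[R]_n) : Prop :=
  solution f sigma I x /\
  forall (J : set R) (y : R -> 'rV[R]_n),
    solution f sigma J y -> I `<=` J -> (forall t, I t -> y t = x t) -> J = I.

Record trajectory (R : realType) (n m : nat) := Trajectory {
  domain : set R;
  state : R -> 'rV[R]_n;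
  signal : R -> modes m }.

Definition maximal_trajectories (R : realType) (n m : nat)
    (f : 'rV[R]_n -> modes m -> 'rV[R]_n) : set (trajectory R n m) :=
  [set p | switching_signal (signal p) /\
           maximal_solution f (signal p) (domain p) (state p)].

Definition closed_covering (R : realType) (n m : nat)
    (chi : modes m -> set 'rV[R]_n) : Prop :=
  (forall c, closed (chi c)) /\ \bigcup_c chi c = [set: 'rV[R]_n].

Definition trajectories_chi (R : realType) (n m : nat)
    (f : 'rV[R]_n -> modes m -> 'rV[R]_n) (chi : modes m -> set 'rV[R]_n) :
    set (trajectory R n m) :=
  [set p | maximal_trajectories f p /\
           forall t, domain p t -> chi (signal p t) (state p t)].

Definition trajectories_adt (R : realType) (n m : nat)
    (f : 'rV[R]_n -> modes m -> 'rV[R]_n) (tauD : R) (N0 : nat) :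
    set (trajectory R n m) :=
  [set p | maximal_trajectories f p /\
           average_dwell_time tauD N0 (signal p)].

(* V is a function on Omega x Gamma; its values off Omega are never used. *)
Definition trajectories_V (R : realType) (n m : nat)
    (f : 'rV[R]_n -> modes m -> 'rV[R]_n) (Omega : set 'rV[R]_n)
    (V : 'rV[R]_n * modes m -> R) : set (trajectory R n m) :=
  [set p | [/\ maximal_trajectories f p,
               forall t, domain p t -> Omega (state p t) &
               forall t t', domain p t -> domain p t' -> t <= t' ->
                 signal p t = signal p t' ->
                 V (state p t', signal p t') <= V (state p t, signal p t)]].

(* Main.v *)
Require Import Defs.
From mathcomp Require Import all_boot all_order all_algebra finmap.
From mathcomp Require Import all_classical all_reals all_analysis.
From mathcomp Require Import lra.

(** Every mode function is bounded on B, so the state curves are uniformly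
    Lipschitz; along an ultrafilter U refining the cofinite filter they converge
    to a Lipschitz curve X, uniformly on compact sets.  Call t > 0 a limit switch
    if no neighbourhood of t is one on which the signals are, U-eventually, a
    common constant.  Near a limit switch the signals switch U-eventually, and
    distinct limit switches have disjoint neighbourhoods, so the dwell-time bound
    for a single signal bounds the number of limit switches in any interval.
    Between limit switches the signals are U-eventually equal to one mode, which
    defines the limit signal.  There, the mean value inequality applied to the
    state curves gives, in the limit, the differential equation for X.  Finally,
    the U-large sets that witness all this form a countable family, and countably
    many U-large sets admit a common subsequence. *)

Set Implicit Arguments.
Unset Strict Implicit.
Unset Printing Implicit Defensive.

Import Order.TTheory GRing.Theory Num.Theory.
Import numFieldNormedType.Exports.

Local Open Scope classical_set_scope.
Local Open Scope ring_scope.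

(** * Intervals and closed conditions on the real line *)

Lemma near_between (R : realType) (a b t : R) :
  a < t < b -> \forall s \near t, a < s < b.
Proof. by have := @near_in_itvoo R a b t; rewrite !inE/=; exact. Qed.

(** Each level set of [h] and its complement are open in the interval, which is connected. *)
Lemma locally_constant_itv (R : realType) (T : Type) (h : R -> T) (a b : R) :
  (forall t, a < t < b -> \forall s \near t, h s = h t) ->
  forall s t, a < s < b -> a < t < b -> h s = h t.
Proof.
move=> lc s t sab tab.
have opP (P : T -> Prop) : open [set u | a < u < b /\ P (h u)].
  rewrite openE => u [uab Pu]; rewrite /interior /=.
  near=> v; split; last by rewrite (near (lc u uab) v).
  by near: v; exact: near_between.
have /connected_intervalP co : is_interval [set u : R | a < u < b].
  move=> x y /andP[ax _] /andP[_ yb] z /andP[xz zy] /=.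
  by rewrite (lt_le_trans ax)// (le_lt_trans zy).
have <- // : [set u | a < u < b /\ h u = h s] t -> h s = h t by case.
rewrite (co [set u | a < u < b /\ h u = h s])//; first by exists s.
- exists [set u | a < u < b /\ h u = h s]; first exact: opP (fun x => x = h s).
  by apply/seteqP; split => u //= [] ? [].
- exists (~` [set u | a < u < b /\ h u <> h s]).
    by rewrite closedC; exact: opP (fun x => x <> h s).
  apply/seteqP; split => u /=; first by case=> uab us; split=> // -[].
  by case=> uab ns; split=> //; apply: contrapT => us; apply: ns.
Unshelve. all: by end_near. Qed.

Lemma closed_le_fun (R : realType) (f g : R -> R) :
  continuous f -> continuous g -> closed [set t | f t <= g t].
Proof.
move=> cf cg.
rewrite (_ : [set _ | _] = (fun t => g t - f t) @^-1` [set x | 0 <= x]).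
  apply: closed_comp; last exact: closed_ge.
  by move=> x _; apply: cvgB; [exact: cg|exact: cf].
by apply/seteqP; split => t /=; rewrite subr_ge0.
Qed.

(** * Mean value inequality *)

Section mean_value_inequality.
Variables (R : realType) (V : normedModType R).
Implicit Types (g : R -> V) (a b K t : R) (v : V).

(** Let [S] be the points of [a, b] at which the estimate from [a] holds. It is closed, so it
    contains its supremum; if that were below [b], the local estimate there would put a larger [s]
    into [S]. *)
Lemma le_local_lipschitz_interior g K a b : continuous g -> a <= b ->
  (forall t, a <= t < b -> \forall s \near t, `|g s - g t| <= K * `|s - t|) ->
  `|g b - g a| <= K * (b - a).
Proof.
move=> cg ab loc.
have cKn c : continuous (fun t => K * (t - c)).
  by move=> t; apply: cvgMr; apply: cvgB; [exact: cvg_id|exact: cvg_cst].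
have cgn c : continuous (fun t => `|g t - g c|).
  by move=> t; apply: cvg_norm; apply: cvgB; [exact: cg|exact: cvg_cst].
pose S := [set t | a <= t <= b /\ `|g t - g a| <= K * (t - a)].
have Sa : S a by split; rewrite ?lexx// !subrr normr0 mulr0.
have ubS : ubound S b by move=> t [/andP[]].
have clS : closed S.
  rewrite (_ : S = `[a, b] `&` [set t | `|g t - g a| <= K * (t - a)]).
    by apply: closedI; [exact: itv_closed|exact: closed_le_fun].
  by apply/seteqP; split => t /=; rewrite in_itv.
have Sc : S (sup S).
  by apply: clS; apply: closure_sup; [exists a|exists b].
have [/andP[ac cb] Kc] := Sc.
move: (cb); rewrite le_eqVlt => /orP[/eqP <-//|cb'].
have acb : a <= sup S < b by rewrite ac.
have : exists s, [/\ sup S < s, s < b & `|g s - g (sup S)| <= K * `|s - sup S|].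
  near ((sup S)^'+) => s; exists s; split.
  - by near: s; exact: nbhs_right_gt.
  - by near: s; exact: nbhs_right_lt.
  - by near: s; apply: cvg_within; exact: loc.
move=> [s [cs sb Hs]].
have : S s.
  split; first by rewrite (ltW sb) andbT (le_trans ac)// ltW.
  rewrite -(subrKA (g (sup S))) (le_trans (ler_normD _ _))//.
  have -> : s - a = s - sup S + (sup S - a) by rewrite subrKA.
  rewrite mulrDr lerD//.
  by move: Hs; rewrite gtr0_norm ?subr_gt0.
move=> /(ub_le_sup (ex_intro _ _ ubS)).
by rewrite leNgt cs.
Unshelve. all: by end_near. Qed.

(** Induction on the exceptional points: one lying inside the interval splits it, and the two bounds
    add up. Once none is left, the bound holds on [t, b] for [t] in ]a, b[ and passes to the limit
    as [t] decreases to [a]. *)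
Lemma le_local_lipschitz g K a b (F : seq R) : continuous g -> a <= b ->
  (forall t, a < t < b -> t \notin F ->
    \forall s \near t, `|g s - g t| <= K * `|s - t|) ->
  `|g b - g a| <= K * (b - a).
Proof.
move=> cg; elim: F a b => [|x F IH] a b ab loc.
  have cKn : continuous (fun t => K * (b - t)).
    by move=> t; apply: cvgMr; apply: cvgB; [exact: cvg_cst|exact: cvg_id].
  have cgn : continuous (fun t => `|g b - g t|).
    by move=> t; apply: cvg_norm; apply: cvgB; [exact: cvg_cst|exact: cg].
  move: ab; rewrite le_eqVlt => /predU1P[->|ab].
    by rewrite !subrr normr0 mulr0.
  apply: (@closed_cvg _ _ (a^'+) _ id _ (closed_le_fun cgn cKn)); last first.
    exact: cvg_within.
  near=> t => /=; apply: le_local_lipschitz_interior => // [|u /andP[tu ub]].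
    by near: t; exact: nbhs_right_le.
  apply: loc => //; rewrite ub andbT (lt_le_trans _ tu)//.
have [/andP[ax xb]|nx] := boolP (a < x < b); last first.
  apply: IH => // t tab tF; apply: loc => //; rewrite inE negb_or tF andbT.
  by apply: contraNneq nx => <-.
have := IH a x (ltW ax); have := IH x b (ltW xb).
move=> Hb Ha; rewrite -(subrKA (g x)) (le_trans (ler_normD _ _))//.
have -> : b - a = b - x + (x - a) by rewrite subrKA.
rewrite mulrDr lerD//.
- apply: Hb => t /andP[xt tb] tF; apply: loc; first by rewrite tb (lt_trans ax).
  by rewrite inE negb_or tF gt_eqF.
- apply: Ha => t /andP[at_ tx] tF; apply: loc; first by rewrite at_ (lt_trans tx).
  by rewrite inE negb_or tF lt_eqF.
Unshelve. all: by end_near. Qed.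

(** Differentiability in multiplied-out form: the estimate is trivial at [s = t], so full
    neighbourhoods replace punctured ones. *)
Definition slope g t v := forall e, 0 < e ->
  \forall s \near t, `|g s - g t - (s - t) *: v| <= e * `|s - t|.

(** After subtraction of [t *: w], a slope within [K] of [w] becomes a local Lipschitz constant
    [K + e / (b - a)], whose slack costs only [e] in total. *)
Lemma mean_value_inequality g w K a b (F : seq R) : continuous g -> a <= b ->
  (forall t, a < t < b -> t \notin F -> exists2 v, slope g t v & `|v - w| <= K) ->
  `|g b - g a - (b - a) *: w| <= K * (b - a).
Proof.
move=> cg ab H; pose h t := g t - t *: w.
have ch : continuous h.
  move=> t; apply: cvgB; first exact: cg.
  by apply: cvgZl; exact: cvg_id.
have hE s t : h s - h t = g s - g t - (s - t) *: w.
  by rewrite /h scalerBl !opprD !opprK addrACA.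
rewrite -hE; apply/ler_addgt0Pr => e e0.
have [ltab|] := ltP a b; last first.
  move=> ba; rewrite (le_anti (introT andP (conj ab ba))).
  by rewrite !subrr normr0 mulr0 add0r ltW.
have ba : 0 < b - a by rewrite subr_gt0.
apply: (@le_trans _ _ ((K + e / (b - a)) * (b - a))); last first.
  by rewrite mulrDl divfK ?gt_eqF.
apply: (@le_local_lipschitz _ _ _ _ F) => // t tab tF.
have [v sv vK] := H t tab tF.
near=> s; rewrite hE.
have -> : g s - g t - (s - t) *: w =
    (s - t) *: (v - w) + (g s - g t - (s - t) *: v).
  by rewrite scalerBr [RHS]addrC subrKA.
rewrite (le_trans (ler_normD _ _))// mulrDl lerD//.
  by rewrite normrZ mulrC ler_wpM2r.
by near: s; apply: sv; rewrite divr_gt0.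
Unshelve. all: by end_near. Qed.

End mean_value_inequality.

(** * Filters, subsequences and finite exceptional sets *)

Lemma filter_forall_seq (T : eqType) (I : Type) (U : set_system I)
    (P : T -> I -> Prop) (s : seq T) : Filter U ->
  (forall x, x \in s -> \forall i \near U, P x i) ->
  \forall i \near U, forall x, x \in s -> P x i.
Proof.
move=> FU; elim: s => [_|x s IH H]; first exact: nearW.
have Hx := H x (mem_head x s).
have /IH Hs : forall y, y \in s -> \near U, P y U.
  by move=> y ys; apply: H; rewrite inE ys orbT.
near=> i => y; rewrite inE => /predU1P[->|]; first by near: i.
by move: y; near: i.
Unshelve. all: by end_near. Qed.

(** Diagonal choice: finitely many U-large sets have arbitrarily large common elements, so each
    [k l] can be taken beyond the previous one and inside every set whose code is below [l]. *)
Lemma extract_subsequence (U : set_system nat) (I : countType)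
    (A : I -> set nat) : ProperFilter U -> \oo `<=` U -> (forall i, U (A i)) ->
  exists2 k : nat -> nat, {homo k : i j / (i < j)%N} &
    forall i, \forall l \near \oo, A i (k l).
Proof.
move=> PU ooU UA.
have step l N : exists m, (N <= m)%N /\
    forall j, (j < l)%N -> forall i : I, choice.unpickle j = Some i -> A i m.
  have H : \forall m \near U, forall j, j \in iota 0 l ->
      forall i : I, choice.unpickle j = Some i -> A i m.
    apply: filter_forall_seq => j _.
    case: (choice.unpickle j) => [i|]; last exact: nearW.
    by apply: filterS (UA i) => m Am _ [<-].
  have HN : \forall m \near U, (N <= m)%N by apply: ooU; exact: nbhs_infty_ge.
  have [m [Nm Hm]] := @filter_ex _ U _ _ (filterI HN H).
  by exists m; split=> // j jl; apply: Hm; rewrite mem_iota.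
have [g Hg] := choice (fun x : nat * nat => step x.1 x.2).
pose k := fix k l := if l is l'.+1 then g (l, (k l').+1) else g (0%N, 0%N).
exists k.
  apply: homo_ltn => [? ? ?|l /=]; first exact: ltn_trans.
  by have [] := Hg (l.+1, (k l).+1).
move=> i; exists (choice.pickle i).+1 => // -[//|l] /= il.
have [_] := Hg (l.+1, (k l).+1); apply; last exact: choice.pickleK.
exact: il.
Qed.

(** Reduces finiteness and the bound together to counting duplicate-free lists: an infinite set
    would contain finite subsets larger than [N]. *)
Lemma finite_set_bounded (T : choiceType) (R : realType) (A : set T) (N : R) :
  (forall s : seq T, uniq s -> (forall x, x \in s -> A x) ->
    (size s)%:R <= N) ->
  finite_set A /\ (#|` fset_set A|)%:R <= N.
Proof.
move=> H; suff fA : finite_set A.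
  split=> //; apply: H => [|x]; first exact: fset_uniq.
  by rewrite in_fset_set// inE.
have N0 : 0 <= N by apply: (H [::]).
apply: contrapT => /(infinite_set_fset (Num.bound N))[B BA NB].
have := H B (fset_uniq B) (fun x xB => BA x xB).
by apply/negP; rewrite -ltNge (lt_le_trans (archi_boundP N0))// ler_nat.
Qed.

(** The nodes are the points of [F] in ]0, T[, sorted, followed by [T]. *)
Lemma piecewise_finite (R : realType) (P : R -> R -> Prop) (F : seq R) (T : R) :
  0 <= T ->
  (forall a b, 0 <= a -> a < b -> b <= T ->
    (forall t, a < t < b -> t \notin F) -> P a b) ->
  piecewise P T.
Proof.
rewrite le_eqVlt => /predU1P[<-|T0] H; first by exists [::].
pose s0 := sort <=%R (undup [seq x <- F | 0 < x < T]).
have s0E x : (x \in s0) = (x \in F) && (0 < x < T).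
  by rewrite mem_sort mem_undup mem_filter andbC.
have ps0 : path <%R 0 s0.
  rewrite path_sortedE; last exact: lt_trans.
  rewrite sort_lt_sorted undup_uniq andbT.
  by apply/allP => x; rewrite s0E => /and3P[].
have ps : path <%R 0 (rcons s0 T).
  rewrite rcons_path ps0 /=.
  have := mem_last 0 s0; rewrite inE => /predU1P[->//|].
  by rewrite s0E => /and3P[].
exists (rcons s0 T); first by split=> //; rewrite last_rcons.
move=> i; rewrite size_rcons => si.
have nthS : nth 0 (rcons s0 T) i = nth 0 (0 :: rcons s0 T) i.+1 by [].
have mono := lt_sorted_ltn_nth 0 (ps : sorted <%R (0 :: rcons s0 T)).
have sz j : (j < (size s0).+2)%N -> j \in [pred n | (n < (size (rcons s0 T)).+1)%N].
  by move=> ?; rewrite inE /= size_rcons.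
have bnd x : x \in 0 :: rcons s0 T -> 0 <= x <= T.
  rewrite inE => /predU1P[->|]; first by rewrite lexx ltW.
  rewrite mem_rcons inE => /predU1P[->|]; first by rewrite lexx ltW.
  by rewrite s0E => /and3P[_ /ltW -> /ltW ->].
have mem j : (j < (size s0).+2)%N -> nth 0 (0 :: rcons s0 T) j \in 0 :: rcons s0 T.
  by move=> ?; apply: mem_nth; rewrite /= size_rcons.
rewrite nthS; apply: H.
- by have /andP[] := bnd _ (mem i (ltnW si)).
- by rewrite mono// sz// ltnW.
- by have /andP[] := bnd _ (mem i.+1 si).
move=> t /andP[it ti]; apply/negP => tF.
have tin : t \in 0 :: rcons s0 T.
  rewrite inE mem_rcons inE s0E tF /=.
  have /andP[i0 _] := bnd _ (mem i (ltnW si)).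
  have /andP[_ iT] := bnd _ (mem i.+1 si).
  by rewrite (le_lt_trans i0 it) (lt_le_trans ti iT) !orbT.
have jsz : (index t (0%R :: rcons s0 T) < (size s0).+2)%N.
  by rewrite -[ltnRHS](_ : size (0 :: rcons s0 T) = _) ?index_mem//= size_rcons.
(* The node [t] would have an index strictly between [i] and [i.+1]. *)
move: it ti; rewrite -(nth_index 0 tin) !mono ?sz//; last exact: ltnW.
by rewrite ltnS => /leq_trans H1 /H1; rewrite ltnn.
Qed.

(** * Derivatives within an interval, reflected curves, finite-valued families *)

Lemma derivative_inP (R : realType) (n : nat) (I : set R) (x : R -> 'rV[R]_n)
    (t : R) (v : 'rV[R]_n) :
  derivative_in I x t v <->
  forall e, 0 < e ->
    \forall s \near t, I s -> `|x s - x t - (s - t) *: v| <= e * `|s - t|.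
Proof.
have E s : s != t ->
    `|x s - x t - (s - t) *: v| = `|v - (s - t)^-1 *: (x s - x t)| * `|s - t|.
  rewrite -subr_eq0 => st; rewrite mulrC -normrZ scalerBr scalerA mulfV// scale1r.
  by rewrite distrC.
split.
  move=> /cvgrPdist_le H e /H; rewrite /dnbhs !near_withinE => He.
  near=> s => Is.
  have [->|st] := eqVneq s t; first by rewrite !subrr scale0r subrr !normr0 mulr0.
  rewrite E// ler_wpM2r//; move: st Is; near: s.
  by apply: filterS He => s Hs st Is; exact: Hs.
move=> H; apply/cvgrPdist_le => e e0; rewrite /dnbhs !near_withinE.
apply: filterS (H e e0) => s Hs st Is.
by rewrite -(@ler_pM2r _ `|s - t|) ?normr_gt0 ?subr_eq0// -E// Hs.
Unshelve. all: by end_near. Qed.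

Lemma slope_derivative_in (R : realType) (n : nat) (I : set R)
    (X : R -> 'rV[R]_n) (t : R) (v : 'rV[R]_n) :
  slope X t v -> derivative_in I X t v.
Proof.
by move=> H; apply/derivative_inP => e /H; apply: filterS => s Hs _.
Qed.

Lemma continuous_comp_norm (R : realType) (T : topologicalType) (x : R -> T) :
  {within [set t | 0 <= t], continuous x} -> continuous (fun t : R => x `|t|).
Proof.
move=> /subspace_continuousP cx t P /= Pt.
have H : nbhs `|t| (fun s => 0 <= s -> P (x s)) := cx _ (normr_ge0 t) P Pt.
have N : nbhs t (fun s => 0 <= `|s| -> P (x `|s|)) :=
  @norm_continuous R R^o t _ H.
by apply: filterS N => s; apply; exact: normr_ge0.
Qed.

(** Otherwise the complements of all level sets would be U-large, and so would their finite
    intersection, which is empty. *)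
Lemma ultra_finite_value (I : Type) (U : set_system I) (T : finType)
    (h : I -> T) : UltraFilter U -> exists c, \forall k \near U, h k = c.
Proof.
move=> UU; apply: contrapT => /forallNP nh.
have H : \forall k \near U, forall c, c \in enum T -> h k <> c.
  apply: filter_forall_seq => c _.
  by have [/nh//|] := in_ultra_setVsetC [set k | h k = c] UU.
have [k Hk] := filter_ex H.
by apply: (Hk (h k)) => //; rewrite mem_enum.
Qed.

(** * The limit signal *)

Section limit_signal.
Variables (R : realType) (m : nat) (tauD : R) (N0 : nat).
Variables (U : set_system nat) (sigma : nat -> R -> modes m).
Hypothesis UU : UltraFilter U.
Hypothesis dwell : forall k, average_dwell_time tauD N0 (sigma k).

Definition eventually_constant (c : modes m) (a b : R) :=
  \forall k \near U, forall t, a < t < b -> sigma k t = c.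

(* The end points are rational in order that countably many U-large sets witness
   all limit modes. *)
Definition limit_mode (c : modes m) (t : R) := exists p q : rat,
  [/\ 0 <= ratr p :> R, ratr p < t < ratr q &
      eventually_constant c (ratr p) (ratr q)].

Definition limit_switch (t : R) := 0 < t /\ forall c, ~ limit_mode c t.

Lemma limit_mode_near c t :
  limit_mode c t -> \forall s \near t, limit_mode c s.
Proof.
move=> [p [q [p0 ptq H]]]; near=> s; exists p, q; split=> //.
by near: s; exact: near_between.
Unshelve. all: by end_near. Qed.

Lemma limit_mode_cvg c t :
  limit_mode c t -> \forall k \near U, sigma k t = c.
Proof. by move=> [p [q [_ ptq]]]; apply: filterS => k; exact. Qed.

Lemma limit_mode_uniq c d t : limit_mode c t -> limit_mode d t -> c = d.
Proof.
move=> /limit_mode_cvg Hc /limit_mode_cvg Hd.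
by have [k [<- <-]] := filter_ex (filterI Hc Hd).
Qed.

Lemma constant_between_switches (s : R -> modes m) (a b : R) : 0 <= a ->
  (forall t, a < t < b -> ~ switching_times s t) ->
  forall t u, a < t < b -> a < u < b -> s t = s u.
Proof.
move=> a0 H; apply: locally_constant_itv => t tab.
have : {for t, continuous s}.
  apply: contrapT => nc; apply: (H t tab); right; split=> //.
  by case/andP: tab => /(le_lt_trans a0).
by move=> /discrete_cvg; exact.
Qed.

(** Otherwise, by the ultrafilter property, the signals are U-eventually free of switches on ]a, b[,
    hence constant there; their value at [t] is U-eventually one mode, which is then a limit mode at
    [t]. *)
Lemma limit_switch_near t a b : limit_switch t -> 0 <= a -> a < t < b ->
  \forall k \near U, exists2 u, a < u < b & switching_times (sigma k) u.
Proof.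
move=> [t0 bad] a0 /andP[at_ tb].
have [//|nU] := in_ultra_setVsetC
  [set k | exists2 u, a < u < b & switching_times (sigma k) u] UU.
have [c Uc] := ultra_finite_value (fun k => sigma k t : 'I_m) UU.
have [p] := rat_in_itvoo at_; rewrite in_itv /= => /andP[ap pt].
have [q] := rat_in_itvoo tb; rewrite in_itv /= => /andP[tq qb].
exfalso; apply: (bad c); exists p, q; split.
- by rewrite (le_trans a0)// ltW.
- by rewrite pt.
near=> k => s /andP[ps sq].
have <- : sigma k t = c by near: k.
apply: (@constant_between_switches (sigma k) a b a0) => [u uab su||].
- have : ~ exists2 u, a < u < b & switching_times (sigma k) u by near: k.
  by apply; exists u.
- by rewrite (lt_trans ap)// (lt_trans sq).
- by rewrite at_.
Unshelve. all: by end_near. Qed.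

(** The listed points have disjoint neighbourhoods inside ]tau1, tau2[. Some single signal switches
    in each of them, so its dwell-time bound also bounds the number of points. *)
Lemma size_limit_switches (s : seq R) (tau1 tau2 : R) : 0 <= tau1 ->
  tau1 < tau2 -> uniq s ->
  (forall t, t \in s -> limit_switch t /\ tau1 < t < tau2) ->
  (size s)%:R <= N0%:R + (tau2 - tau1) / tauD.
Proof.
move=> tau10 tau12 us Hs.
(* A common radius: all small positive [e] suit each of the finitely many points and pairs. *)
have [e He] : exists e, forall x, x \in s ->
    [/\ 0 < e, tau1 <= x - e, x + e <= tau2 &
        forall y, y \in s -> y != x -> e + e <= `|x - y|].
  have Hn : \forall e \near (0 : R)^'+, forall x, x \in s ->
      [/\ 0 < e, tau1 <= x - e, x + e <= tau2 &
       forall y, y \in s -> y != x -> e + e <= `|x - y|].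
    apply: filter_forall_seq => x xs.
    have [_ /andP[t1x xt2]] := Hs x xs.
    have Hy : \forall e \near (0 : R)^'+,
        forall y, y \in s -> y != x -> e + e <= `|x - y|.
      apply: filter_forall_seq => y ys.
      have [->|yx] := eqVneq y x; first exact: nearW.
      near=> e => _; rewrite -mulr2n -mulr_natr -ler_pdivlMr//; near: e.
      by apply: nbhs_right_le; rewrite divr_gt0// normr_gt0 subr_eq0 eq_sym.
    near=> e; split.
    - by near: e; exact: nbhs_right_gt.
    - rewrite lerBrDl -lerBrDr; near: e.
      by apply: nbhs_right_le; rewrite subr_gt0.
    - rewrite -lerBrDl; near: e.
      by apply: nbhs_right_le; rewrite subr_gt0.
    - by near: e.
  exact: filter_ex Hn.
have Hk : \forall k \near U, forall x, x \in s ->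
    exists2 u, x - e < u < x + e & switching_times (sigma k) u.
  apply: filter_forall_seq => x xs; have [e0 t1x xt2 _] := He x xs.
  have [bx _] := Hs x xs; apply: (limit_switch_near bx).
    exact: le_trans tau10 t1x.
  by rewrite ltrDl e0 andbT gtrBl.
have [k {}Hk] := filter_ex Hk.
have Hu x : exists u, x \in s -> x - e < u < x + e /\ switching_times (sigma k) u.
  have [xs|_] := boolP (x \in s); last by exists 0.
  by have [u] := Hk x xs; exists u.
have [u Hsw] := choice Hu.
have [fS] := @dwell k tau1 tau2 tau10 tau12.
apply: le_trans; rewrite ler_nat -(size_map u); apply: uniq_leq_size.
  (* Two points sharing a switching time would be less than [e + e] apart. *)
  rewrite map_inj_in_uniq// => x y xs ys uxy; apply/eqP/negPn/negP => xy.
  have [_ _ _ /(_ _ xs xy)] := He y ys; apply/negP; rewrite -ltNge.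
  have [/andP[h1 h2] _] := Hsw x xs; have [/andP[h3 h4] _] := Hsw y ys.
  by rewrite ltr_norml; move: h1 h2 h3 h4; rewrite uxy => *; apply/andP; split; lra.
move=> _ /mapP[x xs ->]; rewrite in_fset_set// inE /=.
have [/andP[h1 h2] ?] := Hsw x xs; have [_ h3 h4 _] := He x xs.
by split=> //; rewrite (le_lt_trans h3)// (lt_le_trans h2).
Unshelve. all: by end_near. Qed.

Lemma finite_limit_switches (tau1 tau2 : R) : 0 <= tau1 -> tau1 < tau2 ->
  finite_set (limit_switch `&` [set t | tau1 < t < tau2]).
Proof.
move=> tau10 tau12.
have [] := @finite_set_bounded _ _ (limit_switch `&` [set t | tau1 < t < tau2])
  (N0%:R + (tau2 - tau1) / tauD) => // s us Hs.
exact: size_limit_switches.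
Qed.

Lemma limit_switches_seq (T : R) :
  exists F : seq R, forall t, 0 < t < T -> limit_switch t -> t \in F.
Proof.
have [T0|T0] := ltP 0 T; last first.
  by exists [::] => t /andP[t0 /lt_le_trans/(_ T0)/(lt_trans t0)]; rewrite ltxx.
have /finite_seqP[F FE] := finite_limit_switches (lexx 0) T0.
by exists F => t t0T bt; have : [set` F] t by rewrite -FE.
Qed.

(** The limit mode is unique and persists nearby, so it is locally constant on the interval. *)
Lemma limit_mode_itv (a b : R) : 0 <= a -> a < b ->
  (forall t, a < t < b -> ~ limit_switch t) ->
  exists c, forall t, a < t < b -> limit_mode c t.
Proof.
move=> a0 ab H.
have Hm t : exists c, a < t < b -> limit_mode c t.
  (* Off the interval any mode will do; a signal value shows that there is one. *)
  have [tab|_] := boolP (a < t < b); last by exists (sigma 0%N 0).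
  apply: contrapT => /forallNP nh; apply: (H t tab); split.
    by case/andP: tab => /(le_lt_trans a0).
  by move=> c Hc; apply: (nh c).
have [h Hh] := choice Hm.
exists (h ((a + b) / 2)) => t tab.
rewrite (_ : h _ = h t); first exact: Hh.
apply: (@locally_constant_itv _ _ _ a b) => //; last first.
  by rewrite (midf_lt ab).1 (midf_lt ab).2.
move=> u uab.
apply: filterS (filterI (near_between uab) (limit_mode_near (Hh u uab))) => v [vab].
exact/limit_mode_uniq/Hh.
Qed.

Lemma limit_mode_right (t : R) : 0 <= t ->
  exists c, \forall s \near t^'+, limit_mode c s.
Proof.
move=> t0; have tt1 : t < t + 1 by rewrite ltrDl.
have /finite_seqP[F FE] := finite_limit_switches t0 tt1.
have HF : \forall b \near t^'+, forall x, x \in F -> b <= x.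
  apply: filter_forall_seq => x xF; apply: nbhs_right_le.
  by have : [set` F] x by []; rewrite -FE => -[_ /andP[]].
have Hb : \forall b \near t^'+, b < t + 1 by exact: nbhs_right_lt.
have Ht : \forall b \near t^'+, t < b by exact: nbhs_right_gt.
have [b [tb [bt1 bF]]] := filter_ex (filterI Ht (filterI Hb HF)).
have [|c Hc] := limit_mode_itv t0 tb.
  move=> s /andP[ts sb] bad.
  have : [set` F] s by rewrite -FE; split=> //=; rewrite ts (lt_trans sb).
  by move=> /= /bF; rewrite leNgt sb.
exists c; near=> s; apply: Hc; apply/andP; split; near: s.
- exact: nbhs_right_gt.
- exact: nbhs_right_lt.
Unshelve. all: by end_near. Qed.

(** The value at [t] is the limit mode just to the right of [t]: this gives right-continuity and
    settles the values at 0 and at limit switches. *)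
Definition is_limit_signal (S : R -> modes m) :=
  forall t, 0 <= t -> \forall s \near t^'+, limit_mode (S t) s.

Lemma limit_signal_exists : exists S, is_limit_signal S.
Proof.
have H t : exists c, 0 <= t -> \forall s \near t^'+, limit_mode c s.
  have [/limit_mode_right[c Hc]|_] := boolP (0 <= t); first by exists c.
  by exists (sigma 0%N 0).
by have [S HS] := choice H; exists S.
Qed.

Section properties.
Variable S : R -> modes m.
Hypothesis HS : is_limit_signal S.

Lemma limit_signalE c t : limit_mode c t -> S t = c.
Proof.
move=> Hc; have t0 : 0 <= t.
  by move: Hc => [p [q [p0 /andP[pt _] _]]]; rewrite ltW// (le_lt_trans p0).
have Hc' : \forall s \near t^'+, limit_mode c s.
  exact: cvg_within (limit_mode_near Hc).
by near (t^'+) => s; apply: (@limit_mode_uniq _ _ s); near: s; [exact: HS|].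
Unshelve. all: by end_near. Qed.

Lemma limit_signal_switch t : 0 < t -> ~ limit_switch t -> ~ switching_times S t.
Proof.
move=> t0 nb [t00|[_ nc]]; first by rewrite t00 ltxx in t0.
apply: nb; split=> // c Hc; apply: nc.
apply/discrete_cvg; rewrite (limit_signalE Hc).
by apply: filterS (limit_mode_near Hc) => s /limit_signalE.
Qed.

Lemma limit_signal_switching : switching_signal S.
Proof.
split=> [T T0|t t0]; last first.
  apply/discrete_cvg; apply: filterS (HS t0) => s.
  exact: limit_signalE.
have [F HF] := limit_switches_seq T.
apply: (@piecewise_finite _ _ F) => // a b a0 ab bT H.
have [|c Hc] := limit_mode_itv a0 ab.
  move=> t tab /HF tF; have := H t tab; rewrite tF// (le_lt_trans a0).
    by rewrite (lt_le_trans _ bT)//; case/andP: tab.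
  by case/andP: tab.
by exists c => t /Hc /limit_signalE.
Qed.

Lemma limit_signal_dwell : average_dwell_time tauD N0 S.
Proof.
move=> tau1 tau2 tau10 tau12; apply: finite_set_bounded => s us Hs.
apply: size_limit_switches => // t /Hs[st /andP[t1t tt2]].
split; last by rewrite t1t.
apply: contrapT => nb; apply: limit_signal_switch nb st.
exact: le_lt_trans t1t.
Qed.

End properties.
End limit_signal.

(** * Two-sided mean value estimate and limits along an ultrafilter *)

Lemma mean_value_inequality_itv (R : realType) (V : normedModType R)
    (g : R -> V) (w : V) (K a b : R) (F : seq R) : continuous g ->
  (forall t, a < t < b -> t \notin F ->
    exists2 v, slope g t v & `|v - w| <= K) ->
  forall s t, a < s < b -> a < t < b ->
    `|g s - g t - (s - t) *: w| <= K * `|s - t|.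
Proof.
move=> cg H.
have wlog_le s t : a < s < b -> a < t < b -> t <= s ->
    `|g s - g t - (s - t) *: w| <= K * `|s - t|.
  move=> /andP[_ sb] /andP[at_ _] ts.
  rewrite [X in _ <= _ * X]ger0_norm ?subr_ge0//.
  apply: (mean_value_inequality (F := F)) => // u /andP[tu us].
  by apply: H; rewrite (lt_trans at_)// (lt_trans us).
move=> s t sab tab; have [/wlog_le|/ltW] := leP t s; first exact.
move=> /wlog_le => /(_ tab sab).
rewrite [in leRHS]distrC.
by rewrite -normrN opprB opprB addrC -[t - s]opprB scaleNr.
Qed.

(** Compactness gives a cluster point, and an ultrafilter converges to its cluster points. *)
Lemma ultra_compact_cvg (I : Type) (U : set_system I) (T : topologicalType)
    (B : set T) (u : I -> T) : UltraFilter U -> compact B ->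
  (forall k, B (u k)) -> exists2 y, B y & u k @[k --> U] --> y.
Proof.
move=> UU cB uB.
have [y [By cly]] := cB (u k @[k --> U]) _ (nearW _ uB).
exists y => // P Py; have [//|nP] := in_ultra_setVsetC (u @^-1` P) UU.
by have [z [/=]] := cly (~` P) P nP Py.
Qed.

Lemma cvg_norm_le (I : Type) (U : set_system I) (R : realType)
    (V : normedModType R) (u : I -> V) (l : V) (C : R) : ProperFilter U ->
  u k @[k --> U] --> l -> (\forall k \near U, `|u k| <= C) -> `|l| <= C.
Proof. by move=> PU /cvg_norm; exact: cvgr_to_le. Qed.

(** * The limit curve *)

Section limit_curve.
Variables (R : realType) (n m : nat) (f : 'rV[R]_n -> modes m -> 'rV[R]_n).
Hypothesis hf : forall c : modes m, continuous (fun xi => f xi c).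
Variables (tauD : R) (N0 : nat) (U : set_system nat) (sigma : nat -> R -> modes m).
Hypothesis UU : UltraFilter U.
Hypothesis dwell : forall k, average_dwell_time tauD N0 (sigma k).
Variables (B : set 'rV[R]_n) (x : nat -> R -> 'rV[R]_n).
Hypothesis cB : compact B.
Hypothesis cx : forall k, continuous (x k).
Hypothesis xB : forall k t, B (x k t).
Hypothesis slope_x : forall k t, 0 < t -> ~ switching_times (sigma k) t ->
  slope (x k) t (f (x k t) (sigma k t)).

Lemma field_bounded : exists2 M, 0 <= M & forall c y, B y -> `|f y c| <= M.
Proof.
have H : \forall M \near +oo, forall c, c \in enum 'I_m ->
    forall y, B y -> `|f y c| <= M.
  apply: filter_forall_seq => c _.
  have /continuous_compact/(_ cB)/compact_bounded :
      {within B, continuous (fun y => f y c)}.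
    by apply: continuous_subspaceT; exact: hf.
  rewrite /bounded_near/= => Hb; apply: filterS Hb => M HM y By.
    exact: (HM _ (imageP _ By)).
have H0 : \forall M \near +oo, 0 <= M :> R by exact: nbhs_pinfty_ge.
have [M [M0 HM]] := filter_ex (filterI H0 H).
by exists M => // c y By; apply: HM => //; rewrite mem_enum.
Qed.

(** Mean value inequality with [w = 0]; the exceptional points are the switching times between [t]
    and [s], finitely many by the dwell-time condition. *)
Lemma equi_lipschitz : exists2 M, 0 <= M & forall k s t, 0 <= s -> 0 <= t ->
  `|x k s - x k t| <= M * `|s - t|.
Proof.
have [M M0 HM] := field_bounded; exists M => // k.
have wlog_lt s t : 0 <= t -> t < s -> `|x k s - x k t| <= M * `|s - t|.
  move=> t0 ts; have [/finite_seqP[F FE] _] := @dwell k t s t0 ts.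
  have := @mean_value_inequality _ _ (x k) 0 M t s F (@cx k) (ltW ts).
  rewrite scaler0 subr0 gtr0_norm ?subr_gt0//; apply => u tus uF.
  exists (f (x k u) (sigma k u)); last by rewrite subr0; exact: HM.
  apply: slope_x; first by case/andP: tus => /(le_lt_trans t0).
  move=> su; have : [set` F] u by rewrite -FE.
  by rewrite /= (negPf uF).
move=> s t s0 t0; have [ts|st|->] := ltgtP t s.
- exact: wlog_lt.
- by rewrite distrC [X in _ * X]distrC; exact: wlog_lt.
- by rewrite !subrr !normr0 mulr0.
Qed.

Definition is_limit_curve (X : R -> 'rV[R]_n) :=
  [/\ continuous X, (forall t, B (X t)) &
      forall t, 0 <= t -> x k t @[k --> U] --> X t].

Lemma limit_curve_exists : exists X, is_limit_curve X.
Proof.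
have H t : exists y, B y /\ x k t @[k --> U] --> y.
  by have [y By xy] := ultra_compact_cvg UU cB (fun k => xB k t); exists y.
(* The limit is reflected at 0 because the Lipschitz bound is available on [0, +oo[ only. *)
have [X HX] := choice H; exists (fun t => X `|t|); split.
- have [M M0 HM] := equi_lipschitz.
  (* [M] may be 0, and a positive constant is needed as a divisor. *)
  have M1 : 0 < M + 1 by rewrite ltr_wpDl.
  move=> t; apply/cvgrPdist_le => e e0; near=> s.
  have Hst : `|X `|t| - X `|s| | <= M * `|t - s|.
    apply: (cvg_norm_le _ (cvgB (HX `|t|).2 (HX `|s|).2)).
    apply: nearW => k /=; rewrite (le_trans (HM _ _ _ _ _))// ler_wpM2l//.
    exact: ler_dist_dist.
  rewrite (le_trans Hst)// (@le_trans _ _ ((M + 1) * `|t - s|))//.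
    by rewrite ler_wpM2r// lerDl.
  rewrite mulrC -ler_pdivlMr//; near: s.
  by apply: (cvgr_dist_le _ _ cvg_id); exact: divr_gt0.
- by move=> t; have [] := HX `|t|.
- by move=> t t0; have [] := HX `|t|; rewrite ger0_norm.
Unshelve. all: by end_near. Qed.

Section properties.
Variable X : R -> 'rV[R]_n.
Hypothesis HX : is_limit_curve X.

(** Near [t] the curves [x k] U-eventually have slope [f (x k u) c], which is within [e] of
    [f (X t) c] since [x k u] is close to [X t]. The resulting bound on increments passes to the
    limit in [k]. *)
Lemma slope_limit_mode c t :
  limit_mode U sigma c t -> slope X t (f (X t) c).
Proof.
have [cX XB xX] := HX; have [M M0 HM] := equi_lipschitz.
move=> [p [q [p0 /andP[pt tq] Uc]]] e e0.
have t0 : 0 < t by exact: le_lt_trans pt.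
have /cvgrPdist_le/(_ e e0)/nbhs_normP[d /= d0 Hd] := @hf c (X t).
have M1 : 0 < M + 1 by rewrite ltr_wpDl.
(* The first two terms keep [u] inside ]p, q[; the third keeps the Lipschitz drift from [t] to [u]
   below [d / 2], leaving the other half for the distance from [x k t] to [X t]. *)
pose r := Num.min (Num.min (t - ratr p) (ratr q - t)) (d / 2 / (M + 1)).
have r0 : 0 < r by rewrite !lt_min !subr_gt0 pt tq !divr_gt0.
have near_t (u : R) : t - r < u < t + r ->
    [/\ ratr p < u, u < ratr q & M * `|u - t| <= d / 2].
  move=> /andP[h1 h2].
  have : r <= r by []. rewrite {2}/r !le_min => /andP[/andP[r1 r2] r3].
  split; [lra|lra|].
  have ut : `|u - t| <= r by rewrite ler_norml; apply/andP; split; lra.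
  apply: (@le_trans _ _ ((M + 1) * r)); last by rewrite mulrC -ler_pdivlMr.
  by apply: ler_pM => //; rewrite lerDl.
have tr : t - r < t < t + r by rewrite ltrDl gtrBl r0.
apply: filterS (near_between tr) => s sr.
have s0 : 0 <= s by have [ps _ _] := near_t s sr; rewrite ltW// (le_lt_trans p0).
have xl : x k s - x k t - (s - t) *: f (X t) c @[k --> U] -->
    X s - X t - (s - t) *: f (X t) c.
  by apply: cvgB; [apply: cvgB; apply: xX; rewrite // ltW|exact: cvg_cst].
apply: (cvg_norm_le _ xl).
have Ut : \forall k \near U, `|X t - x k t| < d / 2.
  by apply: cvgr_dist_lt; [exact: xX (ltW t0)|rewrite divr_gt0].
apply: filterS (filterI Uc Ut) => k [kc kt].
apply: (mean_value_inequality_itv (F := [::]) _ _ sr tr) => // u utr _.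
have [pu uq Mu] := near_t u utr.
have u0 : 0 < u by exact: le_lt_trans pu.
have ku : sigma k u = c by apply: kc; rewrite pu.
exists (f (x k u) c).
  have := @slope_x k u u0; rewrite ku; apply => -[u00|[_ ]].
    by rewrite u00 ltxx in u0.
  apply; apply/discrete_cvg; rewrite ku.
  have puq : ratr p < u < ratr q by rewrite pu.
  by apply: filterS (near_between puq) => v /kc.
rewrite distrC; apply: Hd => /=.
rewrite -(subrKA (x k t)) (le_lt_trans (ler_normD _ _))// [ltRHS]splitr.
rewrite ltr_leD// (le_trans (HM _ _ _ _ _)) ?(ltW t0) ?(ltW u0)//.
by rewrite distrC.
Qed.

(* A limit switch at which S is continuous (brief excursions to other modes vanish
   in the limit) is crossed by a mean value inequality for X itself. *)
Lemma slope_limit_curve S t : is_limit_signal U sigma S -> 0 < t ->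
  ~ switching_times S t -> slope X t (f (X t) (S t)).
Proof.
have [cX XB xX] := HX; move=> HS t0 nst e e0.
have cS : \forall s \near t, S s = S t.
  have : {for t, continuous S} by apply: contrapT => nc; apply: nst; right.
  by move=> /discrete_cvg; exact.
have cf : \forall s \near t, `|f (X s) (S t) - f (X t) (S t)| <= e.
  have : f (X s) (S t) @[s --> t] --> f (X t) (S t).
    by apply: (cvg_comp X (fun y => f y (S t))); [exact: cX|exact: hf].
  move=> /cvgrPdist_le/(_ e e0); apply: filterS => s; by rewrite distrC.
have t10 : 0 < t + 1 by rewrite addr_gt0.
have /finite_seqP[F FE] := finite_limit_switches UU dwell (lexx 0) t10.
have t01 : 0 < t < t + 1 by rewrite t0 ltrDl ltr01.
have /nbhs_normP[r /= r0 Hr] : \forall u \near t, 0 < u < t + 1 /\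
    (S u = S t /\ `|f (X u) (S t) - f (X t) (S t)| <= e).
  exact: filterI (near_between t01) (filterI cS cf).
have {}Hr u : t - r < u < t + r ->
    (0 < u < t + 1) /\ (S u = S t /\ `|f (X u) (S t) - f (X t) (S t)| <= e).
  by move=> /andP[h1 h2]; apply: Hr; rewrite /= ltr_norml; apply/andP; split; lra.
have tr : t - r < t < t + r by rewrite ltrDl gtrBl r0.
apply: filterS (near_between tr) => s sr.
apply: (mean_value_inequality_itv (F := F) _ _ sr tr) => // u utr uF.
have [u0 [Su fu]] := Hr u utr.
have [c Hc] : exists c, limit_mode U sigma c u.
  apply: contrapT => /forallNP nc.
  have : [set` F] u.
    by rewrite -FE; split=> //; split=> //; case/andP: u0.
  by rewrite /= (negPf uF).
exists (f (X u) c); first exact: slope_limit_mode.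
by rewrite -(limit_signalE UU HS Hc) Su.
Qed.

(** Equi-Lipschitz curves converging at [t] are uniformly close to the limit near [t]; compactness
    of [0, T] in its near-covering form does the rest. *)
Lemma limit_curve_uniform (T e : R) : 0 < e ->
  \forall k \near U, forall t, 0 <= t <= T -> `|x k t - X t| <= e.
Proof.
have [cX XB xX] := HX; have [M M0 HM] := equi_lipschitz.
have M1 : 0 < M + 1 by rewrite ltr_wpDl.
move=> e0.
have Ksub := (compact_near_coveringP `[0, T]).1 (@segment_compact R 0 T).
have e3 : 0 < e / 3 by rewrite divr_gt0.
have : \forall k \near U, `[0, T] `<=` (fun t => 0 <= t -> `|x k t - X t| <= e).
  apply: Ksub => t; rewrite /= in_itv /= => /andP[t0 _].
  exists ([set s | (M + 1) * `|s - t| <= e / 3 /\ `|X t - X s| <= e / 3],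
          [set k | `|X t - x k t| <= e / 3]).
    split=> /=; last by move: (xX t t0) => /cvgrPdist_le; exact.
    apply: filterI; last by move: (cX t) => /cvgrPdist_le; exact.
    near=> s; rewrite mulrC -ler_pdivlMr// distrC; near: s.
    by apply: (cvgr_dist_le _ _ cvg_id); rewrite divr_gt0.
  move=> [s k] /= [[st Xst] xt] s0.
  have -> : x k s - X s = (x k s - x k t) + ((x k t - X t) + (X t - X s)).
    by rewrite !subrKA.
  have -> : e = e / 3 + (e / 3 + e / 3) by lra.
  rewrite (le_trans (ler_normD _ _))// lerD//.
    rewrite (le_trans (HM _ _ _ s0 t0))// (le_trans _ st)// ler_wpM2r//.
    by rewrite lerDl.
  by rewrite (le_trans (ler_normD _ _))// lerD// distrC.
apply: filterS => k Hk t /andP[t0 tT]; apply: Hk => //.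
by rewrite /= in_itv /= t0.
Unshelve. all: by end_near. Qed.

End properties.
End limit_curve.

(** * The limit trajectory *)

Section limit_trajectory.
Variables (R : realType) (n m : nat) (f : 'rV[R]_n -> modes m -> 'rV[R]_n).
Hypothesis hf : forall c : modes m, continuous (fun xi => f xi c).
Variables (tauD : R) (N0 : nat) (U : set_system nat) (sigma : nat -> R -> modes m).
Hypothesis UU : UltraFilter U.
Hypothesis dwell : forall k, average_dwell_time tauD N0 (sigma k).
Variables (B : set 'rV[R]_n) (x : nat -> R -> 'rV[R]_n).
Hypothesis cB : compact B.
Hypothesis cx : forall k, continuous (x k).
Hypothesis xB : forall k t, B (x k t).
Hypothesis slope_x : forall k t, 0 < t -> ~ switching_times (sigma k) t ->
  slope (x k) t (f (x k t) (sigma k t)).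
Variables (X : R -> 'rV[R]_n) (S : R -> modes m).
Hypothesis HX : is_limit_curve U B x X.
Hypothesis HS : is_limit_signal U sigma S.

(** The pieces are cut at the limit switches: between them a single mode [c] rules, and the
    derivative [f (X t) c] is continuous up to the ends. *)
Lemma limit_solution : solution f S [set t | 0 <= t] X.
Proof.
have [cX XB xX] := HX; split; first by left.
- exact: continuous_subspaceT.
- move=> T /= T0; have [F HF] := limit_switches_seq UU dwell T.
  apply: (@piecewise_finite _ _ F) => // a b a0 ab bT H.
  have [|c Hc] := limit_mode_itv (sigma := sigma) UU a0 ab.
    move=> t tab /HF tF; have := H t tab; rewrite tF// (le_lt_trans a0).
      by rewrite (lt_le_trans _ bT)//; case/andP: tab.
    by case/andP: tab.
  exists (fun t => f (X t) c); split.
    apply: continuous_subspaceT => t.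
    by apply: (cvg_comp X (fun y => f y c)); [exact: cX|exact: hf].
  move=> t /Hc Hct; apply: slope_derivative_in.
  exact: (slope_limit_mode hf UU dwell cB cx xB slope_x HX Hct).
- move=> t; rewrite /= le_eqVlt => /predU1P[<- []|t0 nst]; first by left.
  apply: slope_derivative_in.
  exact: (slope_limit_curve hf UU dwell cB cx xB slope_x HX HS).
Qed.

Lemma limit_maximal_solution : maximal_solution f S [set t | 0 <= t] X.
Proof.
split; first exact: limit_solution.
move=> J y [tJ _ _ _] IJ _; apply/seteqP; split => //.
by case: tJ => [->//|[T _ [->|->]]] t /= /andP[].
Qed.

(** Just to the right of [t] the signals U-eventually have mode [S t], so membership passes to [X s]
    along [U], and then to [X t] as [s] decreases to [t]. *)
Lemma limit_trajectory_closed (C : modes m -> set 'rV[R]_n) :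
  (forall c, closed (C c)) -> (forall k t, 0 <= t -> C (sigma k t) (x k t)) ->
  forall t, 0 <= t -> C (S t) (X t).
Proof.
have [cX XB xX] := HX; move=> clC HC t t0.
apply: (@closed_cvg _ _ (t^'+) _ X _ (clC (S t))); last first.
  by apply: cvg_within_filter; exact: cX.
have Hge : \forall s \near t^'+, 0 <= s.
  by near=> s; rewrite (le_trans t0)//; near: s; exact: nbhs_right_ge.
apply: filterS2 Hge (HS t0) => s s0 Hs.
apply: (@closed_cvg _ _ U _ (fun k => x k s) _ (clC (S t))); last exact: xX.
by apply: filterS (limit_mode_cvg UU Hs) => k <-; exact: HC.
Unshelve. all: by end_near. Qed.

(** The signals may fail to converge to [S] at [t] or [t'], so the values are compared at [t + h]
    and [t' + h], where the limit mode is [S t] both times: first along [U], then as [h] decreases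
    to 0. *)
Lemma limit_trajectory_nonincreasing (V : modes m -> 'rV[R]_n -> R) :
  (forall c y, B y -> {for y, continuous (V c)}) ->
  (forall k t t', 0 <= t -> 0 <= t' -> t <= t' -> sigma k t = sigma k t' ->
    V (sigma k t') (x k t') <= V (sigma k t) (x k t)) ->
  forall t t', 0 <= t -> 0 <= t' -> t <= t' -> S t = S t' ->
    V (S t') (X t') <= V (S t) (X t).
Proof.
have [cX XB xX] := HX; move=> cV HV t t' t0 t'0 tt' Stt'.
have right_lim (u : R) : V (S t) (X (u + h)) @[h --> 0^'+] --> V (S t) (X u).
  apply: (cvg_comp (fun h => X (u + h)) (V (S t))); last exact: cV.
  apply: (cvg_comp (fun h => u + h) X); last exact: cX.
  have : u + h @[h --> 0^'+] --> u + 0.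
    by apply: cvgD; [exact: cvg_cst|apply: cvg_within_filter; exact: cvg_id].
  by rewrite addr0.
rewrite -Stt'; apply: ler_cvg_to (right_lim t') (right_lim t) _.
have /nbhs_right0P H := HS t0.
have /nbhs_right0P H' := HS t'0.
have Hge : \forall h \near (0 : R)^'+, 0 <= h by exact: nbhs_right_ge.
apply: filterS3 Hge H H' => h h0 Hh; rewrite -Stt' => Hh'.
have th0 : 0 <= t + h by rewrite addr_ge0.
have t'h0 : 0 <= t' + h by rewrite addr_ge0.
have lim_k (u : R) : 0 <= u -> V (S t) (x k u) @[k --> U] --> V (S t) (X u).
  by move=> u0; apply: (cvg_comp (fun k => x k u) (V (S t))); [exact: xX|exact: cV].
apply: ler_cvg_to (lim_k _ t'h0) (lim_k _ th0) _.
apply: filterS2 (limit_mode_cvg UU Hh) (limit_mode_cvg UU Hh') => k <- E.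
by rewrite -{1}E; apply: HV; rewrite ?E// lerD2r.
Qed.

Lemma limit_subsequence : \oo `<=` U -> exists2 k : nat -> nat,
    {homo k : i j / (i < j)%N} &
    (forall T e : R, 0 < e -> \forall l \near \oo,
      forall t, 0 <= t <= T -> `|x (k l) t - X t| <= e) /\
    (forall c t, limit_mode U sigma c t -> \forall l \near \oo, sigma (k l) t = c).
Proof.
move=> ooU.
(* Sets of the first kind are implications, so as to be U-large for every index. Those of the second
   kind couple horizon and tolerance in one [N], so that countably many handle all [T] and [e]. *)
pose A (i : (rat * rat * 'I_m) + nat) : set nat := match i with
  | inl (p, q, c) => [set k | eventually_constant U sigma c (ratr p) (ratr q) ->
      forall t, ratr p < t < ratr q -> sigma k t = c]
  | inr N => [set k | forall t, 0 <= t <= N%:R -> `|x k t - X t| <= N.+1%:R^-1]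
  end.
have UA i : U (A i).
  case: i => [[[p q] c]|N] /=.
    have [H|nH] := pselect (eventually_constant U sigma c (ratr p) (ratr q)).
      by apply: filterS H => k Hk _.
    by apply: nearW => k /nH.
  by apply: (limit_curve_uniform hf UU dwell cB cx xB slope_x HX); rewrite invr_gt0.
have [k kmono kA] := extract_subsequence _ ooU UA.
exists k => //; split=> [T e e0|c t [p [q [p0 ptq H]]]].
  have [N [TN Ne]] : exists N : nat, T <= N%:R /\ N.+1%:R^-1 <= e.
    have HT : \forall N \near \oo, T <= N%:R by exact: nbhs_infty_ger.
    have He : \forall N \near \oo, N.+1%:R^-1 < e :=
      near_infty_natSinv_lt (PosNum e0).
    have [N [? /ltW ?]] := filter_ex (filterI HT He).
    by exists N.
  apply: filterS (kA (inr N)) => l Hl t /andP[t0 tT].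
  by rewrite (le_trans _ Ne)// Hl// t0 (le_trans tT).
by apply: filterS (kA (inl (p, q, c))) => l; apply.
Qed.

End limit_trajectory.

(** * Convergence on compact sets and almost everywhere *)

Lemma uniform_cvg_compact (R : realType) (V : normedModType R)
    (u : nat -> R -> V) (v : R -> V) :
  (forall T e : R, 0 < e -> \forall l \near \oo,
    forall t, 0 <= t <= T -> `|u l t - v t| <= e) ->
  forall K : set R, compact K -> K `<=` [set t | 0 <= t] ->
    {uniform K, u @ \oo --> v}.
Proof.
move=> H K /compact_bounded; rewrite /bounded_near /= => /filter_ex[T KT] K0 P.
move=> /uniform_nbhs[E [entE EP]].
move: entE; rewrite -entourage_from_ballE => -[e /= e0 eE].
have e20 : 0 < e / 2 by rewrite divr_gt0.
apply: filterS (H T _ e20) => l Hl; apply: EP => t Kt; apply: eE => /=.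
rewrite -ball_normE /= distrC (le_lt_trans (Hl t _))//.
  by rewrite K0// (le_trans (ler_norm _))// KT.
by rewrite ltr_pdivrMr// ltr_pMr// ltr1n.
Qed.

(** The set is countable, each ]0, N + 1[ containing finitely many limit switches. The point 0 is
    adjoined because it has no limit mode and yet is not a limit switch. *)
Lemma limit_switches_negligible (R : realType) (m : nat) (tauD : R) (N0 : nat)
    (U : set_system nat) (sigma : nat -> R -> modes m) : UltraFilter U ->
  (forall k, average_dwell_time tauD N0 (sigma k)) ->
  (@lebesgue_measure R).-negligible (0 |` limit_switch U sigma).
Proof.
move=> UU dwell.
have cL : countable (0 |` limit_switch U sigma).
  have : countable (\bigcup_N (0 |` (limit_switch U sigma `&`
      [set t | 0 < t < N.+1%:R]))).
    apply: bigcup_countable => // N _; apply: finite_set_countable.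
    by rewrite finite_setU; split => //; exact: (finite_limit_switches UU dwell).
  apply: sub_countable; apply: subset_card_le => t [->|st].
    by exists 0%N => //; left.
  exists (Num.bound t) => //; right; split=> //=; case: st => t0 _.
  rewrite t0 (lt_trans (archi_boundP (ltW t0)))// ltr_nat//.
apply/negligibleP; last exact: countable_lebesgue_measure0.
exact: countable_measurable.
Qed.

Theorem lemmaA2 (R : realType) (n m : nat)
    (f : 'rV[R]_n -> modes m -> 'rV[R]_n)
    (hf : forall c : modes m, continuous (fun xi => f xi c))
    (chi : modes m -> set 'rV[R]_n) (hchi : closed_covering chi)
    (Omega : set 'rV[R]_n) (hOmega : open Omega)
    (V : 'rV[R]_n * modes m -> R)
    (hV : {within Omega `*` [set: modes m], continuous V})
    (tauD : R) (htauD : 0 < tauD) (N0 : nat) (hN0 : (0 < N0)%N)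
    (p : nat -> trajectory R n m)
    (hp : forall k, (trajectories_V f Omega V `&` trajectories_chi f chi `&`
                     trajectories_adt f tauD N0) (p k))
    (B : set 'rV[R]_n) (hB : compact B) (hBOmega : B `<=` Omega)
    (hpB : forall k (t : R), 0 <= t -> domain (p k) t /\ B (state (p k) t)) :
  exists (k : nat -> nat) (q : trajectory R n m),
    [/\ {homo k : i j / (i < j)%N},
        (trajectories_V f Omega V `&` trajectories_chi f chi `&`
         trajectories_adt f tauD N0) q,
        domain q = [set t | 0 <= t],
        (forall K : set R, compact K -> K `<=` [set t | 0 <= t] ->
           {uniform K, (fun l => state (p (k l))) @ \oo --> state q}) &
        {ae @lebesgue_measure R, forall t : R, 0 <= t ->
           (fun l => signal (p (k l)) t) @ \oo --> signal q t}].
Proof.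
have maxp k : maximal_trajectories f (p k) by have [[[]]] := hp k.
(* Time intervals lie in [0, +oo[; [hpB] gives the reverse inclusion. *)
have domp k : domain (p k) = [set t | 0 <= t].
  have [_ [[tI _ _ _] _]] := maxp k; apply/seteqP; split => t; last first.
    by move=> /(hpB k)[].
  by case: tI => [->//|[T _ [->|->]]] /= /andP[].
pose sigma k := signal (p k).
(* The curves are reflected at 0 to be continuous on the whole line. *)
pose x k (t : R) := state (p k) `|t|.
have dwell k : average_dwell_time tauD N0 (sigma k) by have [_ []] := hp k.
have xE k t : 0 <= t -> x k t = state (p k) t by move=> t0; rewrite /x ger0_norm.
have cx k : continuous (x k).
  have [_ [[_ c _ _] _]] := maxp k; apply: continuous_comp_norm.
  by rewrite -(domp k).
have xB k t : B (x k t) by have [] := hpB k `|t| (normr_ge0 t).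
have slope_x k t : 0 < t -> ~ switching_times (sigma k) t ->
    slope (x k) t (f (x k t) (sigma k t)).
  move=> t0 nst e e0; have [_ [[_ _ _ Hd] _]] := maxp k.
  have /derivative_inP/(_ e e0) := Hd t (hpB k t (ltW t0)).1 nst.
  have t01 : 0 < t < t + 1 by rewrite t0 ltrDl ltr01.
  apply: filterS2 (near_between t01) => s /andP[/ltW s0 _].
  by rewrite domp /= !xE ?(ltW t0)//; exact.
have [U [UU ooU]] := ultraFilterLemma (eventually_filter : ProperFilter \oo).
have [X HX] := limit_curve_exists hf UU dwell hB cx xB slope_x.
have [S HS] := limit_signal_exists UU dwell.
have [k kmono [kx ksigma]] :=
  limit_subsequence hf UU dwell hB cx xB slope_x HX ooU.
have [cX XB xX] := HX.
have maxq : maximal_trajectories f (Trajectory [set t | 0 <= t] X S).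
  split; first exact: (limit_signal_switching UU dwell HS).
  exact: (limit_maximal_solution hf UU dwell hB cx xB slope_x HX HS).
exists k, (Trajectory [set t | 0 <= t] X S); split=> //.
- split; [split; split=> //=|split=> //=].
  + by move=> t t0; apply: hBOmega.
  + apply: (limit_trajectory_nonincreasing UU HX HS (V := fun c y => V (y, c))).
      (* Continuity within [Omega] times the modes restricts to the slice of mode [c], and openness
         of [Omega] turns it into continuity at [y]. *)
      move=> c y By P /= Py.
      have /subspace_continuousP/(_ (y, c) (conj (hBOmega _ By) I) P Py) := hV.
      move=> [[Q1 Q2] /= [Q1y Q2c] Q12].
      apply: filterS2 (open_nbhs_nbhs (conj hOmega (hBOmega _ By))) Q1y => z zO zQ1.
      by apply: (Q12 (z, c)); split=> //=; exact: nbhs_singleton.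
    move=> i t t' t0 t'0 tt' E; have [[[_ _ Vi] _] _] := hp i.
    by rewrite !xE//; apply: Vi => //; rewrite domp.
  + apply: (limit_trajectory_closed UU HX HS) => [c|i t t0].
      by case: hchi.
    have [[_ [_ chii]] _] := hp i.
    by rewrite xE//; apply: chii; rewrite domp.
  + exact: (limit_signal_dwell UU dwell HS).
- apply: (uniform_cvg_compact (u := fun l => state (p (k l)))) => T e e0.
  apply: filterS (kx T e e0) => l Hl t t0T; rewrite -xE ?Hl//.
  by case/andP: t0T.
(* Off the negligible set each [t >= 0] has a limit mode, which is both [S t] and the eventual value
   of the chosen signals. *)
- apply: negligibleS (limit_switches_negligible UU dwell) => t /=.
  move=> nt; apply: contrapT => ns; apply: nt => t0.
  have [c Hc] : exists c, limit_mode U sigma c t.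
    apply: contrapT => /forallNP nc; apply: ns.
    move: t0; rewrite le_eqVlt => /predU1P[<-|t0]; [by left|right].
    by split.
  apply/discrete_cvg; rewrite (limit_signalE UU HS Hc).
  exact: ksigma.
Qed.
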